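(* Let $f$ be an objective function with computational structure $(\mathcal{G},\{\varphi_v\},\{\ell_v\})$, all $\varphi_v,\ell_v$ being twice continuously differentiable. Let $S_V=(S_v)_{v\in V}$ be feasible, i.e. $S_v\in U_v$ for all $v$ and $S_v=\varphi_v(S_{\delta^{+}(v)})$ for every $v\in V$ with $\delta^{+}(v)\neq\emptyset$, and let the multipliers be $\lambda_v=\partial_v f$ for every $v$ with $\delta^{+}(v)\neq\emptyset$, where $\partial_v f$ is given by the reverse recursion stated in the context, evaluated at $S_V$. Then the Newton step for $f$ at $S_X$ is given by the Lagrange-Newton step at $(S_V,\lambda)$. That is, a vector $\delta S_X$ satisfies $$\nabla^2 f(S_X)\,\delta S_X=-\nabla f(S_X)$$ if and only if it is the $X$-component of $\delta S_V$ for some solution $(\delta S_V,\delta\lambda)$ of $$\begin{bmatrix}\partial_V^2\mathcal{L} & (\partial_V h)^{T}\\ \partial_V h & 0\end{bmatrix}\begin{bmatrix}\delta S_V\\ \delta\lambda\end{bmatrix}=\begin{bmatrix}-\partial_V\mathcal{L}\\ -h\end{bmatrix},$$ with $\mathcal{L}$, $h$ and their derivatives evaluated at $(S_V,\lambda)$.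
   Context: $\mathcal{G}$ is a finite directed acyclic graph with vertex set $V=V[\mathcal{G}]$. For $v\in V$, $\delta^{+}(v)$ is the set of parents of $v$ and $\delta^{-}(v)$ the set of children. Each vertex $v$ carries a state $S_v\in U_v$, with $U_v\subset\mathbb{R}^{n_v}$ open; for $A\subset V$, $S_A$ is the labelled concatenation of $(S_v)_{v\in A}$. The input nodes are $X=\{x_1,\dots,x_n\}=\{v\in V:\delta^{+}(v)=\emptyset\}$. Computational structure: for each non-input $v$ there is a function $\varphi_v:\prod_{z\in\delta^{+}(v)}U_z\to U_v$, and for each $v\in V$ a local objective $\ell_v:\prod_{z\in\{v\}\cup\delta^{+}(v)}U_z\to\mathbb{R}$. The objective $f:U_{x_1}\times\dots\times U_{x_n}\to\mathbb{R}$ has computational structure $(\mathcal{G},\{\varphi_v\},\{\ell_v\})$ if $$f(S_{x_1},\dots,S_{x_n})=\sum_{v\in V}\ell_v(S_{\{v\}\cup\delta^{+}(v)}),$$ where the states of non-input nodes are defined recursively from the inputs by $S_v:=\varphi_v(S_{\delta^{+}(v)})$. Reverse recursion: starting from childless nodes and proceeding backward along $\mathcal{G}$, define the (column) vectors $\partial_v f\in\mathbb{R}^{n_v}$ for all $v\in V$ by $$\partial_v f=\sum_{s\in\{v\}\cup\delta^{-}(v)}\partial_v\ell_s+\sum_{d\in\delta^{-}(v)}(\partial_v d)^{T}\,\partial_d f,\qquad \partial_v d:=\frac{\partial\varphi_d(S_{\delta^{+}(d)})}{\partial S_v}\ \text{ for } v\in\delta^{+}(d),$$ where $\partial_v\ell_s$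 is the partial gradient of $\ell_s$ with respect to $S_v$. Lagrangian of the constrained form: for each non-input $v$ put $h_v(S_{\{v\}\cup\delta^{+}(v)})=\varphi_v(S_{\delta^{+}(v)})-S_v$, let $h$ be the concatenation of all $h_v$, let $\lambda$ be the concatenation of multipliers $\lambda_v\in\mathbb{R}^{n_v}$ over non-input $v$, and, regarding all states $S_V$ as independent variables, set $$\mathcal{L}(S_V,\lambda)=\sum_{v\in V}\ell_v(S_{\{v\}\cup\delta^{+}(v)})+\sum_{v\in V,\ \delta^{+}(v)\neq\emptyset}\lambda_v^{T}h_v(S_{\{v\}\cup\delta^{+}(v)}).$$ $\partial_V\mathcal{L}$ and $\partial_V^2\mathcal{L}$ are the gradient and Hessian of $\mathcal{L}$ with respect to $S_V$, and $\partial_V h$ is the Jacobian of $h$ with respect to $S_V$. A Newton step for $f$ at $S_X$ is a vector $\delta S_X$ with $\nabla^2 f(S_X)\,\delta S_X=-\nabla f(S_X)$; a Lagrange-Newton step at $(S_V,\lambda)$ is a solution $(\delta S_V,\delta\lambda)$ of the displayed linear (KKT) system. *)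

(* Defs.v *)
(* MathComp / MathComp-Analysis *)
From HB Require Import structures.
From mathcomp Require Import all_boot all_order all_algebra.
From mathcomp Require Import boolp classical_sets functions reals topology.
From mathcomp Require Import normedtype derive.
Set Implicit Arguments.
Unset Strict Implicit.
Unset Printing Implicit Defensive.
Import Order.TTheory GRing.Theory Num.Theory.
Import numFieldNormedType.Exports.
Local Open Scope ring_scope.

(** * Differential calculus on column vectors *)

(* The usual class C^k: all functions involved are total, but only their values
   and derivatives at points of the (open) set A matter. *)
Fixpoint cont_diff (R : realType) (E F : normedModType R) (k : nat)
    (A : set E) (g : E -> F) : Prop :=
  match k with
  | 0 => forall x, A x -> {for x, continuous g}
  | k'.+1 => (forall x, A x -> differentiable g x) /\
             (forall v : E, cont_diff k' A ('D_v g))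
  end.

(* Rows are indexed by outputs and columns by inputs, which is the transpose of
   the library's [jacobian] for row vectors. *)
Definition jac (R : realType) (p q : nat) (g : 'cV[R]_p -> 'cV[R]_q)
    (x : 'cV[R]_p) : 'M[R]_(q, p) :=
  \matrix_(i < q, j < p) ('D_(delta_mx j 0) g x) i 0.

Definition grad (R : realType) (p : nat) (g : 'cV[R]_p -> R)
    (x : 'cV[R]_p) : 'cV[R]_p :=
  \col_(i < p) 'D_(delta_mx i 0) g x.

Definition hess (R : realType) (p : nat) (g : 'cV[R]_p -> R)
    (x : 'cV[R]_p) : 'M[R]_p :=
  jac (grad g) x.

(** * Directed acyclic graphs; [e u v] means that [u] is a parent of [v] *)

(* [cycle e c] is a closed walk along [e]; loops are included. *)
Definition acyclic (V : finType) (e : rel V) : Prop :=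
  forall c : seq V, cycle e c -> c = [::].

Definition parents (V : finType) (e : rel V) (v : V) : {set V} :=
  finset (fun u => e u v).

Definition children (V : finType) (e : rel V) (v : V) : {set V} :=
  finset (fun d => e v d).

Definition inputs (V : finType) (e : rel V) : {set V} :=
  finset (fun v => parents e v == finset.set0).

Definition noninputs (V : finType) (e : rel V) : {set V} :=
  finset (fun v => parents e v != finset.set0).

(** * Labelled concatenations *)

Definition states (R : realType) (V : finType) (n : V -> nat) : Type :=
  forall v : V, 'cV[R]_(n v).

(* The scalar coordinates of S_A: pairs (v, k) with v in A and k < n v. *)
Definition coords (V : finType) (n : V -> nat) (A : {set V}) :
    {set {v : V & 'I_(n v)}} :=
  finset (fun c => tag c \in A).

Definition ncoords (V : finType) (n : V -> nat) (A : {set V}) : nat :=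
  #|coords n A|.

Definition concat (R : realType) (V : finType) (n : V -> nat) (A : {set V})
    (S : states R n) : 'cV[R]_(ncoords n A) :=
  \col_i S (tag (enum_val i)) (tagged (enum_val i)) 0.

(* The blocks of a concatenation. The sum has exactly one term if v is in A;
   it is empty, and the block is 0, otherwise. *)
Definition block (R : realType) (V : finType) (n : V -> nat) (A : {set V})
    (s : 'cV[R]_(ncoords n A)) : states R n :=
  fun v => \col_(k < n v)
    \sum_(i < ncoords n A | enum_val i == Tagged (fun u => 'I_(n u)) k) s i 0.

(* The product of the U_v, v in A, as a set of concatenated vectors. *)
Definition prodU (R : realType) (V : finType) (n : V -> nat)
    (U : forall v : V, set 'cV[R]_(n v)) (A : {set V}) :
    set 'cV[R]_(ncoords n A) :=
  fun s => forall v, v \in A -> U v (block s v).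

(** * Computational structures *)

Definition transitions (R : realType) (V : finType) (e : rel V)
    (n : V -> nat) : Type :=
  forall v : V, 'cV[R]_(ncoords n (parents e v)) -> 'cV[R]_(n v).

Definition local_objectives (R : realType) (V : finType) (e : rel V)
    (n : V -> nat) : Type :=
  forall v : V, 'cV[R]_(ncoords n (v |: parents e v)) -> R.

(* The recursion S_v := phi_v(S_parents(v)) along the graph; it leaves the
   states of the input nodes free and ignores phi_v there. *)
Definition feasible (R : realType) (V : finType) (e : rel V) (n : V -> nat)
    (U : forall v : V, set 'cV[R]_(n v)) (phi : transitions R e n)
    (S : states R n) : Prop :=
  (forall v, U v (S v)) /\
  (forall v, v \in noninputs e -> S v = phi v (concat (parents e v) S)).

(* When [e] is acyclic and each phi_v maps into U_v, every input vector in the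
   product of the U_x extends to exactly one feasible S, so this determines f
   on that product. *)
Definition has_structure (R : realType) (V : finType) (e : rel V)
    (n : V -> nat) (U : forall v : V, set 'cV[R]_(n v))
    (phi : transitions R e n) (ell : local_objectives R e n)
    (f : 'cV[R]_(ncoords n (inputs e)) -> R) : Prop :=
  forall S : states R n, feasible U phi S ->
    f (concat (inputs e) S) =
    \sum_(v : V) ell v (concat (v |: parents e v) S).

(** * Reverse recursion *)

(* [dfwith S u] is S with the state of v replaced by u. *)
Definition partial_grad (R : realType) (V : finType) (n : V -> nat)
    (A : {set V}) (g : 'cV[R]_(ncoords n A) -> R) (S : states R n) (v : V) :
    'cV[R]_(n v) :=
  grad (fun u : 'cV[R]_(n v) => g (concat A (dfwith S u))) (S v).

Definition partial_jac (R : realType) (V : finType) (n : V -> nat)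
    (A : {set V}) (q : nat) (g : 'cV[R]_(ncoords n A) -> 'cV[R]_q)
    (S : states R n) (v : V) : 'M[R]_(q, n v) :=
  jac (fun u : 'cV[R]_(n v) => g (concat A (dfwith S u))) (S v).

(* For acyclic [e] this recursion, run backward from the childless nodes, has
   exactly one solution df. *)
Definition reverse_recursion (R : realType) (V : finType) (e : rel V)
    (n : V -> nat) (phi : transitions R e n) (ell : local_objectives R e n)
    (S df : states R n) : Prop :=
  forall v : V,
    df v = \sum_(s in v |: children e v) partial_grad (ell s) S v
         + \sum_(d in children e v) (partial_jac (phi d) S v)^T *m df d.

(** * Lagrangian of the constrained form *)

Definition constraint_at (R : realType) (V : finType) (e : rel V)
    (n : V -> nat) (phi : transitions R e n) (S : states R n) : states R n :=
  fun v => phi v (concat (parents e v) S) - S v.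

Definition constraint (R : realType) (V : finType) (e : rel V) (n : V -> nat)
    (phi : transitions R e n) (s : 'cV[R]_(ncoords n [set: V])) :
    'cV[R]_(ncoords n (noninputs e)) :=
  concat (noninputs e) (constraint_at phi (block s)).

Definition lagrangian (R : realType) (V : finType) (e : rel V) (n : V -> nat)
    (phi : transitions R e n) (ell : local_objectives R e n)
    (s : 'cV[R]_(ncoords n [set: V]))
    (lambda : 'cV[R]_(ncoords n (noninputs e))) : R :=
  \sum_(v : V) ell v (concat (v |: parents e v) (block s)) +
  \sum_(v in noninputs e)
    ((block lambda v)^T *m constraint_at phi (block s) v) 0 0.

(** * Newton and Lagrange-Newton steps *)

Definition newton_step (R : realType) (p : nat) (g : 'cV[R]_p -> R)
    (x dx : 'cV[R]_p) : Prop :=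
  hess g x *m dx = - grad g x.

Definition lagrange_newton_step (R : realType) (V : finType) (e : rel V)
    (n : V -> nat) (phi : transitions R e n) (ell : local_objectives R e n)
    (s : 'cV[R]_(ncoords n [set: V]))
    (lambda : 'cV[R]_(ncoords n (noninputs e)))
    (ds : 'cV[R]_(ncoords n [set: V]))
    (dlambda : 'cV[R]_(ncoords n (noninputs e))) : Prop :=
  let L := fun t => lagrangian phi ell t lambda in
  let h := constraint phi in
  block_mx (hess L s) (jac h s)^T
           (jac h s)  0           *m col_mx ds dlambda
  = col_mx (- grad L s) (- h s).

(* Main.v *)
Require Import Defs.
From HB Require Import structures.
From mathcomp Require Import all_boot all_order all_algebra.
From mathcomp Require Import boolp classical_sets functions reals topology.
From mathcomp Require Import normedtype landau derive.
Set Implicit Arguments.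
Unset Strict Implicit.
Unset Printing Implicit Defensive.
Import Order.TTheory GRing.Theory Num.Theory.
Import numFieldNormedType.Exports.
Local Open Scope ring_scope.

(** The idea is to see the objective as the Lagrangian along the feasible
    manifold. Propagating the inputs through the graph defines a map E from
    input vectors to vectors of all states ([all_states]). The constraint h
    vanishes on the range of E, so for every fixed multiplier lambda
    f = L(E(.), lambda) near S_X. With J the Jacobian of E at S_X, the chain
    rule gives grad f = J^T grad L, and
    hess f = J^T (hess L) J + sum_j (d_j L) hess E_j.

    The last sum vanishes. If j is a coordinate of an input node, E_j is linear.
    If j is a coordinate of a noninput node v, then d_j L = 0: in the partial
    gradient of L at v, the multiplier lambda_v enters as - lambda_v, and the
    equation lambda_v = d_v f of the reverse recursion says exactly that this
    cancels the other terms ([grad_lagrangian_noninput]). Hence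
    hess f = J^T (hess L) J ([hess_objective]), with the multiplier frozen.

    What remains is linear algebra ([reduced_newton_kkt]). Let A be the Jacobian
    of h at S_V and Q the selection of the input blocks. Differentiating
    h(E(x)) = 0 and Q E(x) = x gives A J = 0 and Q J = 1, and A d = 0 with
    Q d = 0 forces d = 0, because A d = 0 is the linearized recursion, which
    determines all blocks of d from its input blocks ([constraint_jac_inj]). As
    h = 0 at S_V, the lower half of the KKT system says A d = 0.
    So J parametrizes the kernel of A by the input component, and a covector
    killed by J^T is a combination of the rows of A. Therefore
    J^T ((hess L) J dx + grad L) = 0 holds iff (hess L) J dx + grad L = - A^T dl
    for some dl, which is the KKT system with d = J dx.

    Acyclicity enters twice: in the existence of E, obtained by iterating one
    round of simultaneous evaluation of all transitions as many times as there
    are vertices, and in the propagation argument for A. *)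

(** * Directional derivatives of maps on column vectors *)

(** Differentiability at a point is local: the first-order expansion only involves
    values near the point. This is needed because the chain and product rules
    give formulas for derivatives that hold only on an open set. *)
Lemma near_eq_differentiable (R : realType) (E F : normedModType R)
    (g k : E -> F) (x : E) :
  {near x, g =1 k} -> differentiable g x -> differentiable k x.
Proof.
move=> gk dg.
have dk : k \o shift x = cst (k x) + 'd g x +o_ (0 : E) id.
  rewrite -(nbhs_singleton gk).
  have /eqaddoP dg0 := diff_locally dg.
  apply/eqaddoP => eps eps0.
  have gk0 : \forall h \near (0 : E), g (h + x) = k (h + x).
    move: gk; rewrite (near_shift 0) /= => gk.
    near=> h; suff : g (h + (x - 0)) = k (h + (x - 0)) by rewrite subr0.
    by near: h.
  near=> h.
  suff : `|((g \o shift x) - (cst (g x) + 'd g x)) h| <= eps * `|id h|.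
    by rewrite !fctE /= (near gk0 h).
  by near: h; exact: dg0.
apply/diff_locallyP; rewrite (diff_unique (diff_continuous dg) dk); split => //.
exact: diff_continuous.
Unshelve. all: by end_near. Qed.

Lemma derive_coord (R : realType) (E : normedModType R) (q : nat)
    (g : E -> 'cV[R]_q) (x v : E) (i : 'I_q) :
  differentiable g x -> ('D_v g x) i 0 = 'D_v (fun y => g y i 0) x.
Proof.
by move=> dg; rewrite derive_mx ?mxE//; exact: diff_derivable.
Qed.

Lemma differentiable_cV (R : realType) (E : normedModType R) (q : nat)
    (g : E -> 'cV[R]_q) (x : E) :
  (forall i, differentiable (fun y => g y i 0) x) -> differentiable g x.
Proof.
move=> dg.
have -> : g = \sum_(i < q) (fun y => g y i 0 *: (delta_mx i 0 : 'cV[R]_q)).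
  apply/funext => y; rewrite fct_sumE [LHS]matrix_sum_delta.
  by apply: eq_bigr => i _; rewrite big_ord1.
by apply: differentiable_sum => i; apply: differentiableZl.
Qed.

Lemma differentiable_coordP (R : realType) (E : normedModType R) (q : nat)
    (g : E -> 'cV[R]_q) (x : E) (i : 'I_q) :
  differentiable g x -> differentiable (fun y => g y i 0) x.
Proof.
move=> dg; apply: (@differentiable_comp _ _ _ _ g (fun N : 'cV[R]_q => N i 0)) => //.
exact: differentiable_coord.
Qed.

Lemma derive_dirE (R : realType) (q : nat) (F : normedModType R)
    (g : 'cV[R]_q -> F) (x v : 'cV[R]_q) :
  differentiable g x -> 'D_v g x = \sum_j v j 0 *: 'D_(delta_mx j 0) g x.
Proof.
move=> dg; rewrite deriveE // [in LHS](matrix_sum_delta v) linear_sum.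
by apply: eq_bigr => j _; rewrite big_ord1 linearZ /= deriveE.
Qed.

Lemma derive_comp (R : realType) (E F G : normedModType R)
    (f : E -> F) (g : F -> G) (x v : E) :
  differentiable f x -> differentiable g (f x) ->
  'D_v (g \o f) x = 'D_('D_v f x) g (f x).
Proof.
move=> df dg; rewrite !deriveE //; last exact: differentiable_comp.
by rewrite diff_comp.
Qed.

(** Both sides are limits of literally the same difference quotients. This
    identifies derivatives in one block of states
    with derivatives in a direction of the space of all states. *)
Lemma derive_affine_comp (R : realType) (E F G : normedModType R)
    (p : E -> F) (g : F -> G) (x v : E) (w : F) :
  (forall h : R, p (h *: v + x) = h *: w + p x) ->
  'D_v (g \o p) x = 'D_w g (p x).
Proof.
by move=> pE; rewrite /derive; under eq_fun do rewrite /= pE.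
Qed.

Lemma open_near_eq (T : topologicalType) (W : Type) (A : set T) (g k : T -> W) x :
  open A -> A x -> (forall y, A y -> g y = k y) -> {near x, g =1 k}.
Proof.
move=> Aop Ax gk; near=> y; apply: gk; near: y.
exact: open_nbhs_nbhs.
Unshelve. all: by end_near. Qed.

Lemma derive_linear_fun (R : realType) (E F : normedModType R) (p : E -> F)
    (x v : E) :
  (forall (h : R) y, p (h *: v + y) = h *: p v + p y) -> 'D_v p x = p v.
Proof.
move=> plin; have -> : p = id \o p by [].
by rewrite (derive_affine_comp _ (w := p v)) ?derive_id.
Qed.

Lemma derive_bigsum (R : realType) (E : normedModType R) (I : Type)
    (r : seq I) (P : pred I) (g : I -> E -> R) (x v : E) :
  (forall i, P i -> differentiable (g i) x) ->
  'D_v (fun y => \sum_(i <- r | P i) g i y) x =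
  \sum_(i <- r | P i) 'D_v (g i) x.
Proof.
move=> dg.
suff [] : differentiable (fun y => \sum_(i <- r | P i) g i y) x /\
  'D_v (fun y => \sum_(i <- r | P i) g i y) x =
  \sum_(i <- r | P i) 'D_v (g i) x by [].
elim: r => [|i r [IHd IHD]].
  under eq_fun do rewrite big_nil.
  rewrite big_nil; split; [exact: differentiable_cst | exact: derive_cst].
under eq_fun do rewrite big_cons; rewrite big_cons.
case Pi: (P i) => //; have dgi := dg i Pi.
split; first exact: differentiableD.
by rewrite -IHD; apply: deriveD; apply: diff_derivable.
Qed.

Lemma jac_mul_derive (R : realType) (p q : nat) (g : 'cV[R]_p -> 'cV[R]_q)
    (x v : 'cV[R]_p) : differentiable g x -> jac g x *m v = 'D_v g x.
Proof.
move=> dg; rewrite [RHS]derive_dirE //; apply/colP => i.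
rewrite summxE [LHS]mxE; apply: eq_bigr => j _.
by rewrite [jac _ _ _ _]mxE [RHS]mxE mulrC.
Qed.

(** * Twice differentiable functions *)

(** Real-valued on purpose: a vector-valued map is treated through its
    coordinates, so that stability under composition follows from the first-order
    chain rule, which writes a derivative as a sum of products. *)
Definition twice_diff (R : realType) (E : normedModType R) (A : set E)
    (g : E -> R) : Prop :=
  forall x, A x -> differentiable g x /\ forall v, differentiable ('D_v g) x.

(** Enough to have, on the open set, some differentiable formula for each
    directional derivative. *)
Lemma twice_diff_derive (R : realType) (E : normedModType R) (A : set E)
    (g : E -> R) (dg : E -> E -> R) :
  open A -> (forall x, A x -> differentiable g x) ->
  (forall v x, A x -> 'D_v g x = dg v x) ->
  (forall v x, A x -> differentiable (dg v) x) -> twice_diff A g.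
Proof.
move=> Aop dgA gE ddg x Ax; split=> [|v]; first exact: dgA.
apply: near_eq_differentiable (ddg v x Ax).
by apply: (open_near_eq Aop Ax) => y /gE->.
Qed.

Lemma twice_diff_cst (R : realType) (E : normedModType R) (A : set E) (c : R) :
  twice_diff A (fun _ : E => c).
Proof.
move=> x Ax; split=> [|v]; first exact: differentiable_cst.
have -> : 'D_v (fun _ : E => c) = cst 0 by apply/funext => y; exact: derive_cst.
exact: differentiable_cst.
Qed.

Lemma derive_coord_id (R : realType) (p : nat) (i : 'I_p) (x v : 'cV[R]_p) :
  'D_v (fun y : 'cV[R]_p => y i 0) x = v i 0.
Proof.
by rewrite -(@derive_coord _ _ _ id) // derive_id.
Qed.

Lemma twice_diff_coord (R : realType) (p : nat) (A : set 'cV[R]_p) (i : 'I_p) :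
  twice_diff A (fun y : 'cV[R]_p => y i 0).
Proof.
move=> x Ax; split=> [|v]; first exact: differentiable_coord.
have -> : 'D_v (fun y : 'cV[R]_p => y i 0) = cst (v i 0).
  by apply/funext => y; exact: derive_coord_id.
exact: differentiable_cst.
Qed.

Lemma twice_diffD (R : realType) (E : normedModType R) (A : set E)
    (g k : E -> R) :
  open A -> twice_diff A g -> twice_diff A k ->
  twice_diff A (fun x => g x + k x).
Proof.
move=> Aop dg dk.
apply: (twice_diff_derive (dg := fun v x => 'D_v g x + 'D_v k x) Aop).
- by move=> x Ax; apply: differentiableD; [case: (dg x Ax)|case: (dk x Ax)].
- move=> v x Ax; apply: deriveD; apply: diff_derivable;
    by [case: (dg x Ax)|case: (dk x Ax)].
- move=> v x Ax; apply: differentiableD;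
    by [case: (dg x Ax)|case: (dk x Ax)].
Qed.

Lemma twice_diffM (R : realType) (E : normedModType R) (A : set E)
    (g k : E -> R) :
  open A -> twice_diff A g -> twice_diff A k ->
  twice_diff A (fun x => g x * k x).
Proof.
move=> Aop dg dk.
apply: (twice_diff_derive
  (dg := fun v x => g x * 'D_v k x + k x * 'D_v g x) Aop).
- by move=> x Ax; apply: differentiableM; [case: (dg x Ax)|case: (dk x Ax)].
- move=> v x Ax; apply: deriveM; apply: diff_derivable;
    by [case: (dg x Ax)|case: (dk x Ax)].
- move=> v x Ax; have [dgx ddgx] := dg x Ax; have [dkx ddkx] := dk x Ax.
  by apply: differentiableD; apply: differentiableM.
Qed.

Lemma twice_diff_sum (R : realType) (E : normedModType R) (A : set E)
    (I : Type) (r : seq I) (P : pred I) (g : I -> E -> R) :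
  open A -> (forall i, P i -> twice_diff A (g i)) ->
  twice_diff A (fun x => \sum_(i <- r | P i) g i x).
Proof.
move=> Aop dg; elim: r => [|i r IHr].
  have -> : (fun x => \sum_(i <- [::] | P i) g i x) = fun=> 0.
    by apply/funext => x; rewrite big_nil.
  exact: twice_diff_cst.
case Pi: (P i); last first.
  by under eq_fun do rewrite big_cons Pi.
under eq_fun do rewrite big_cons Pi.
by apply: twice_diffD => //; apply: dg.
Qed.

Lemma derive_comp_cV (R : realType) (E : normedModType R) (q : nat)
    (f : E -> 'cV[R]_q) (g : 'cV[R]_q -> R) (x v : E) :
  (forall i, differentiable (fun y => f y i 0) x) -> differentiable g (f x) ->
  'D_v (g \o f) x =
  \sum_j 'D_v (fun y => f y j 0) x * 'D_(delta_mx j 0) g (f x).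
Proof.
move=> dfi dg; have df := differentiable_cV dfi.
rewrite derive_comp // derive_dirE //.
by apply: eq_bigr => j _; rewrite derive_coord.
Qed.

Lemma twice_diff_comp (R : realType) (E : normedModType R) (q : nat)
    (A : set E) (B : set 'cV[R]_q) (f : E -> 'cV[R]_q) (g : 'cV[R]_q -> R) :
  open A -> (forall x, A x -> B (f x)) ->
  (forall j, twice_diff A (fun x => f x j 0)) -> twice_diff B g ->
  twice_diff A (g \o f).
Proof.
move=> Aop fAB df dg.
have dfx x : A x -> differentiable f x.
  by move=> Ax; apply: differentiable_cV => j; case: (df j x Ax).
apply: (twice_diff_derive (dg := fun v x =>
  \sum_j 'D_v (fun y => f y j 0) x * 'D_(delta_mx j 0) g (f x)) Aop).
- move=> x Ax; apply: differentiable_comp; first exact: dfx.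
  by case: (dg _ (fAB x Ax)).
- move=> v x Ax; apply: derive_comp_cV; last by case: (dg _ (fAB x Ax)).
  by move=> j; case: (df j x Ax).
- move=> v x Ax.
  have -> : (fun x => \sum_j 'D_v (fun y => f y j 0) x *
                        'D_(delta_mx j 0) g (f x)) =
            \sum_j (fun x => 'D_v (fun y => f y j 0) x *
                        'D_(delta_mx j 0) g (f x)).
    by apply/funext => y; rewrite fct_sumE.
  apply: differentiable_sum => j; apply: differentiableM.
    by case: (df j x Ax).
  apply: (@differentiable_comp _ _ _ _ f ('D_(delta_mx j 0) g)).
    exact: dfx.
  by case: (dg _ (fAB x Ax)).
Qed.

Lemma cont_diff2_coord (R : realType) (E : normedModType R) (q : nat)
    (A : set E) (g : E -> 'cV[R]_q) (i : 'I_q) :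
  open A -> cont_diff 2 A g -> twice_diff A (fun x => g x i 0).
Proof.
move=> Aop [dg ddg]; apply: (twice_diff_derive (dg := fun v x => 'D_v g x i 0) Aop).
- by move=> x Ax; apply: differentiable_coordP; apply: dg.
- by move=> v x Ax; rewrite derive_coord //; apply: dg.
- move=> v x Ax; apply: differentiable_coordP.
  by case: (ddg v) => ddgv _; apply: ddgv.
Qed.

Lemma cont_diff2_twice (R : realType) (E : normedModType R) (A : set E)
    (g : E -> R) : cont_diff 2 A g -> twice_diff A g.
Proof.
move=> [dg ddg] x Ax; split=> [|v]; first exact: dg.
by case: (ddg v) => ddgv _; apply: ddgv.
Qed.

(** * Hessian of a composition *)

(** The second-order chain rule in coordinates: differentiate once more the
    first-order formula, each summand of which is a product. *)
Lemma derive2_comp_cV (R : realType) (E : normedModType R) (q : nat)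
    (A : set E) (B : set 'cV[R]_q) (f : E -> 'cV[R]_q) (g : 'cV[R]_q -> R)
    (x v w : E) :
  open A -> (forall x, A x -> B (f x)) ->
  (forall j, twice_diff A (fun x => f x j 0)) -> twice_diff B g -> A x ->
  'D_w ('D_v (g \o f)) x =
  \sum_j ('D_v (fun y => f y j 0) x *
            (\sum_k 'D_w (fun y => f y k 0) x *
                    'D_(delta_mx k 0) ('D_(delta_mx j 0) g) (f x)) +
          'D_(delta_mx j 0) g (f x) * 'D_w ('D_v (fun y => f y j 0)) x).
Proof.
move=> Aop fAB df dg Ax.
have dfy j y : A y -> differentiable (fun y => f y j 0) y.
  by move=> Ay; case: (df j y Ay).
have ddf j : differentiable ('D_v (fun y => f y j 0)) x by case: (df j x Ax).
have dgy y : A y -> differentiable g (f y) by move=> /fAB/dg[].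
have ddg j : differentiable ('D_(delta_mx j 0) g) (f x).
  by case: (dg (f x) (fAB x Ax)).
have ddgf j : differentiable ('D_(delta_mx j 0) g \o f) x.
  by apply: differentiable_comp => //; apply: differentiable_cV => k; apply: dfy.
transitivity ('D_w (\sum_j (fun x => 'D_v (fun y => f y j 0) x *
                        ('D_(delta_mx j 0) g \o f) x)) x).
  apply: near_eq_derive; apply: (open_near_eq Aop Ax) => y Ay.
  rewrite fct_sumE; apply: derive_comp_cV; last exact: dgy.
  by move=> j; apply: dfy.
rewrite derive_sum; last first.
  by move=> j; apply: diff_derivable; apply: differentiableM.
apply: eq_bigr => j _.
rewrite (@deriveM _ _ ('D_v (fun y => f y j 0)) ('D_(delta_mx j 0) g \o f));
  try exact: diff_derivable.
by rewrite derive_comp_cV // => k; apply: dfy.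
Qed.

Lemma near_eq_grad (R : realType) (p : nat) (g k : 'cV[R]_p -> R)
    (x : 'cV[R]_p) : {near x, g =1 k} -> grad g x = grad k x.
Proof.
by move=> gk; apply/colP => i; rewrite !mxE; exact: near_eq_derive.
Qed.

Lemma hessE (R : realType) (p : nat) (A : set 'cV[R]_p) (g : 'cV[R]_p -> R)
    (x : 'cV[R]_p) (i j : 'I_p) :
  twice_diff A g -> A x ->
  hess g x i j = 'D_(delta_mx j 0) ('D_(delta_mx i 0) g) x.
Proof.
move=> dg Ax; have [_ ddg] := dg x Ax; rewrite mxE derive_coord; last first.
  apply: differentiable_cV => k.
  by under eq_fun do rewrite mxE.
by under eq_fun do rewrite mxE.
Qed.

Lemma near_eq_hess (R : realType) (p : nat) (A : set 'cV[R]_p)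
    (g k : 'cV[R]_p -> R) (x : 'cV[R]_p) :
  open A -> A x -> (forall y, A y -> g y = k y) -> hess g x = hess k x.
Proof.
move=> Aop Ax gk.
have gradE j : 'D_(delta_mx j 0) (grad g) x = 'D_(delta_mx j 0) (grad k) x.
  apply: near_eq_derive; apply: (open_near_eq Aop Ax) => y Ay.
  exact: near_eq_grad (open_near_eq Aop Ay gk).
by apply/matrixP => i j; rewrite [LHS]mxE [RHS]mxE gradE.
Qed.

Section CompStationary.
Variables (R : realType) (p q : nat) (A : set 'cV[R]_p) (B : set 'cV[R]_q).
Variables (f : 'cV[R]_p -> 'cV[R]_q) (g : 'cV[R]_q -> R) (x : 'cV[R]_p).
Hypotheses (Aop : open A) (fAB : forall y, A y -> B (f y)).
Hypotheses (df : forall j, twice_diff A (fun y => f y j 0)).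
Hypotheses (dg : twice_diff B g) (Ax : A x).

Let jac_coord i j : jac f x i j = 'D_(delta_mx j 0) (fun y => f y i 0) x.
Proof.
rewrite mxE derive_coord //; apply: differentiable_cV => k.
by case: (df k Ax).
Qed.

Lemma grad_comp : grad (g \o f) x = (jac f x)^T *m grad g (f x).
Proof.
apply/colP => i; rewrite !mxE derive_comp_cV.
- by apply: eq_bigr => j _; rewrite mxE jac_coord !mxE.
- by move=> j; case: (df j Ax).
- by case: (dg (fAB Ax)).
Qed.

(** For each intermediate coordinate j, the second-order chain rule contributes
    d_j g times the Hessian of f_j; under the hypothesis one of these two
    factors is zero for every j, and only the congruence by the Jacobian is
    left. *)
Lemma hess_comp_stationary :
  (forall j, grad g (f x) j 0 = 0 \/
     forall v w, 'D_w ('D_v (fun y => f y j 0)) x = 0) ->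
  hess (g \o f) x = (jac f x)^T *m hess g (f x) *m jac f x.
Proof.
move=> stat; apply/matrixP => i j.
rewrite (hessE _ _ (twice_diff_comp Aop fAB df dg) Ax).
rewrite (derive2_comp_cV _ _ Aop fAB df dg Ax) -mulmxA mxE.
apply: eq_bigr => a _; rewrite [_^T _ _]mxE jac_coord.
rewrite [X in _ + X](_ : _ = 0) ?addr0; last first.
  by case: (stat a) => [|->]; rewrite ?mulr0 // mxE => ->; rewrite mul0r.
congr (_ * _); rewrite mxE; apply: eq_bigr => b _.
by rewrite (hessE _ _ dg (fAB Ax)) jac_coord mulrC.
Qed.

End CompStationary.

(** * Block elimination in a KKT system *)

Lemma mulmx_cV_inj (R : nzRingType) (m p : nat) (M N : 'M[R]_(m, p)) :
  (forall d : 'cV_p, M *m d = N *m d) -> M = N.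
Proof.
move=> MN; apply/matrixP => i j; have := MN (delta_mx j 0).
by rewrite -!colE => /colP/(_ i); rewrite !mxE.
Qed.

(** The cokernel of M is a matrix whose columns M annihilates. *)
Lemma injective_row_full (F : fieldType) (m N : nat) (M : 'M[F]_(m, N)) :
  (forall d : 'cV_N, M *m d = 0 -> d = 0) -> row_full M.
Proof.
move=> Minj; rewrite -cokermx_eq0; apply/eqP/matrixP => i j.
have /Minj/colP/(_ i) : M *m col j (cokermx M) = 0.
  by rewrite colE mulmxA mulmx_coker mul0mx.
by rewrite !mxE.
Qed.

(** J is a basis of the kernel of the constraint Jacobian A, normalized by Q. Left
    to right, the residual w satisfies J^T w = 0; the rows of A and Q together
    span everything, so w = A^T a + Q^T b, and applying J^T gives b = 0. Right to
    left, applying J^T eliminates the multiplier, and d = J (Q d). *)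
Lemma reduced_newton_kkt (F : fieldType) (N m p : nat) (H : 'M[F]_N)
    (A : 'M[F]_(m, N)) (Q : 'M[F]_(p, N)) (J : 'M[F]_(N, p))
    (g : 'cV[F]_N) (dx : 'cV[F]_p) :
  A *m J = 0 -> Q *m J = 1%:M ->
  (forall d : 'cV_N, A *m d = 0 -> Q *m d = 0 -> d = 0) ->
  J^T *m H *m J *m dx = - (J^T *m g) <->
  exists (d : 'cV[F]_N) (dl : 'cV[F]_m),
    block_mx H A^T A 0 *m col_mx d dl = col_mx (- g) 0 /\ dx = Q *m d.
Proof.
move=> AJ QJ inj; split=> [newton|[d [dl [/eqP]]]].
  (* A vector killed by A and Q is 0, so the rows of A and Q span all covectors. *)
  have full : row_full (col_mx A Q).
    apply: injective_row_full => d; rewrite mul_col_mx.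
    by rewrite -[0]vsubmxK => /eq_col_mx[]; rewrite !linear0; apply: inj.
  pose w := - g - H *m (J *m dx).
  have Jw : J^T *m w = 0.
    by rewrite mulmxBr mulmxN !mulmxA -newton subrr.
  have /submxP [c wE] := submx_full w^T full.
  exists (J *m dx), (lsubmx c)^T; split; last by rewrite mulmxA QJ mul1mx.
  have {}wE : w = A^T *m (lsubmx c)^T + Q^T *m (rsubmx c)^T.
    by rewrite -[w]trmxK wE -[c in LHS]hsubmxK mul_row_col linearD /= !trmx_mul.
  (* The Q-component of the residual is J^T w. *)
  have c2 : (rsubmx c)^T = 0.
    move: Jw; rewrite wE mulmxDr !mulmxA -(trmx_mul A) -(trmx_mul Q) AJ QJ.
    by rewrite trmx0 mul0mx add0r trmx1 mul1mx.
  rewrite mul_block_col mul0mx addr0 (mulmxA A) AJ mul0mx; congr col_mx.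
  by move: wE; rewrite c2 mulmx0 addr0 => <-; rewrite /w addrC subrK.
rewrite mul_block_col mul0mx addr0 => /eqP/eq_col_mx[row1 row2] dxE.
have dE : d = J *m dx.
  apply/eqP; rewrite -subr_eq0; apply/eqP; apply: inj; rewrite mulmxBr mulmxA.
    by rewrite AJ mul0mx row2 subrr.
  by rewrite QJ mul1mx dxE subrr.
rewrite -!mulmxA -dE -mulmxN -row1 mulmxDr.
by rewrite (mulmxA J^T A^T) -trmx_mul AJ trmx0 mul0mx addr0.
Qed.

(** * Blocks of labelled concatenations *)

Section LabelledConcatenation.
Variables (R : realType) (V : finType) (n : V -> nat).
Implicit Types (A B : {set V}) (S T : states R n).

(** The sum defining a block has a single term at a coordinate that occurs in the
    concatenation. *)
Lemma block_coord A (s : 'cV[R]_(ncoords n A)) (v : V) (k : 'I_(n v))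
    (i : 'I_(ncoords n A)) :
  enum_val i = Tagged (fun u => 'I_(n u)) k -> block s v k 0 = s i 0.
Proof.
move=> iE; rewrite mxE (big_pred1 i) // => j.
by rewrite -iE (inj_eq enum_val_inj).
Qed.

Lemma coords_enum_val A (v : V) (k : 'I_(n v)) : v \in A ->
  exists i : 'I_(ncoords n A), enum_val i = Tagged (fun u => 'I_(n u)) k.
Proof.
move=> vA; have cA : Tagged (fun u => 'I_(n u)) k \in coords n A by rewrite inE.
by exists (enum_rank_in cA (Tagged (fun u => 'I_(n u)) k)); rewrite enum_rankK_in.
Qed.

Lemma tag_enum_val A (i : 'I_(ncoords n A)) : tag (enum_val i) \in A.
Proof. by have := enum_valP i; rewrite inE. Qed.

Lemma block_concat A S v : v \in A -> block (concat A S) v = S v.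
Proof.
move=> vA; apply/colP => k; have [i iE] := coords_enum_val k vA.
by rewrite (block_coord _ iE) mxE iE.
Qed.

Lemma concatE A S (v : V) (k : 'I_(n v)) (i : 'I_(ncoords n A)) :
  enum_val i = Tagged (fun u => 'I_(n u)) k -> concat A S i 0 = S v k 0.
Proof. by move=> iE; rewrite mxE iE. Qed.

Lemma block_concatT S : block (concat [set: V] S) = S.
Proof. by apply: functional_extensionality_dep => v; rewrite block_concat ?inE. Qed.

Lemma concat_eq A S T : (forall v, v \in A -> S v = T v) -> concat A S = concat A T.
Proof.
by move=> ST; apply/colP => i; rewrite !mxE ST // tag_enum_val.
Qed.

Lemma concat_block A (s : 'cV[R]_(ncoords n A)) : concat A (block s) = s.
Proof.
apply/colP => i; rewrite mxE (@block_coord _ _ _ _ i) //.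
by case: (enum_val i).
Qed.

Lemma block_linear A (h : R) (s t : 'cV[R]_(ncoords n A)) v :
  block (h *: s + t) v = h *: block s v + block t v.
Proof.
apply/colP => k; rewrite !mxE mulr_sumr -big_split.
by apply: eq_bigr => i _; rewrite !mxE.
Qed.

Lemma concat_linear A (h : R) S T :
  concat A (fun v => h *: S v + T v) = h *: concat A S + concat A T.
Proof. by apply/colP => i; rewrite !mxE. Qed.

Lemma block0 A v : block (0 : 'cV[R]_(ncoords n A)) v = 0.
Proof. by apply/colP => k; rewrite !mxE big1 // => i _; rewrite mxE. Qed.

(** Composing with this linear map turns a function of the states in A into a
    function of the states in B. The blocks at vertices of A outside B are 0. *)
Definition restr A B (s : 'cV[R]_(ncoords n B)) := concat A (block s).

Lemma restr_linear A B (h : R) (s t : 'cV[R]_(ncoords n B)) :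
  restr A (h *: s + t) = h *: restr A s + restr A t.
Proof.
by rewrite -concat_linear; apply: concat_eq => v _; exact: block_linear.
Qed.

(** Provides the selection matrix Q of [reduced_newton_kkt]. *)
Lemma restr_mxE A B : exists Q : 'M[R]_(ncoords n A, ncoords n B),
  forall s, restr A s = Q *m s.
Proof.
exists (\matrix_(i, j) (enum_val j == enum_val i)%:R) => s; apply/colP => i.
rewrite !mxE big_mkcond; apply: eq_bigr => j _.
rewrite mxE; case: (enum_val i) => v k /=.
by case: eqP => _; rewrite ?mul1r ?mul0r.
Qed.

Lemma block_delta A (v : V) (k : 'I_(n v)) (i : 'I_(ncoords n A)) (u : V)
    (l : 'I_(n u)) :
  enum_val i = Tagged (fun u => 'I_(n u)) k ->
  block (delta_mx i 0 : 'cV[R]_(ncoords n A)) u l 0 =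
  (Tagged (fun u => 'I_(n u)) k == Tagged (fun u => 'I_(n u)) l)%:R.
Proof.
move=> iE; rewrite mxE; have [kl|nkl] := eqVneq.
  by rewrite (big_pred1 i) ?mxE ?eqxx // => j; rewrite -kl -iE (inj_eq enum_val_inj).
rewrite big1 // => j /eqP jE; rewrite mxE.
by case: eqP => // ji; rewrite -jE ji iE eqxx in nkl.
Qed.

Lemma block_delta_in A (v : V) (k : 'I_(n v)) (i : 'I_(ncoords n A)) :
  enum_val i = Tagged (fun u => 'I_(n u)) k ->
  block (delta_mx i 0 : 'cV[R]_(ncoords n A)) v = delta_mx k 0.
Proof.
move=> iE; apply/colP => l; rewrite (block_delta l iE) eq_Tagged /= mxE.
by rewrite eqxx andbT eq_sym.
Qed.

Lemma block_delta_out A (v : V) (k : 'I_(n v)) (i : 'I_(ncoords n A)) (u : V) :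
  enum_val i = Tagged (fun u => 'I_(n u)) k -> u != v ->
  block (delta_mx i 0 : 'cV[R]_(ncoords n A)) u = 0.
Proof.
move=> iE uv; apply/colP => l; rewrite (block_delta l iE) [RHS]mxE.
by case: eqP => // /(congr1 (@tag _ _)) /= vu; rewrite vu eqxx in uv.
Qed.

(** Moving the state of the single vertex v along its k-th axis is moving all
    states along the corresponding coordinate axis. *)
Lemma dfwith_delta A S (v : V) (k : 'I_(n v)) (i : 'I_(ncoords n A)) (h : R) :
  enum_val i = Tagged (fun u => 'I_(n u)) k ->
  dfwith S (h *: delta_mx k 0 + S v) =
  (fun u => h *: block (delta_mx i 0 : 'cV[R]_(ncoords n A)) u + S u).
Proof.
move=> iE; apply: functional_extensionality_dep => u.
case: dfwithP => [|u' vu]; first by rewrite (block_delta_in iE).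
by rewrite (block_delta_out iE) ?scaler0 ?add0r // eq_sym.
Qed.

End LabelledConcatenation.

Arguments restr {R V n} A {B} s.
Arguments block_delta_in {R V n A v k i}.
Arguments block_delta_out {R V n A v k i} u.

(** * Acyclic graphs *)

(** The ancestors of u are ancestors of v, and v is one of its own ancestors but
    not one of u, as that would close a cycle. Thus the number of ancestors is a
    height function for the graph, bounded by the number of vertices. *)
Lemma ancestors_lt (V : finType) (e : rel V) (u v : V) :
  acyclic e -> e u v ->
  (#|[pred w | connect e w u]| < #|[pred w | connect e w v]|)%N.
Proof.
move=> ac euv; apply: proper_card; apply/fintype.properP; split.
  apply/fintype.subsetP => w; rewrite !inE => wu.
  exact: connect_trans wu (connect1 euv).
exists v; rewrite !inE ?connect0 //; apply/negP => /connectP[p pth lst].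
by have /ac : cycle e (v :: p) by rewrite /= rcons_path pth -lst.
Qed.

Lemma acyclic_ind (V : finType) (e : rel V) (P : V -> Prop) :
  acyclic e -> (forall v, (forall u, e u v -> P u) -> P v) -> forall v, P v.
Proof.
move=> ac IH v; have [k] := ubnP #|[pred w | connect e w v]|.
elim: k v => // k IHk v lek; apply: IH => u /(ancestors_lt ac) ltuv.
by apply: IHk; apply: leq_trans ltuv _.
Qed.

(** * Product domains *)

Section Products.
Variables (R : realType) (V : finType) (n : V -> nat).
Variable U : forall v : V, set 'cV[R]_(n v).
Arguments U : clear implicits.

Lemma twice_diff_block (A : {set V}) (O : set 'cV[R]_(ncoords n A)) v k :
  open O -> twice_diff O (fun s : 'cV[R]_(ncoords n A) => block s v k 0).
Proof.
move=> Oop; under eq_fun do rewrite mxE.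
by apply: twice_diff_sum => // i _; apply: twice_diff_coord.
Qed.

Lemma differentiable_block (A : {set V}) (s : 'cV[R]_(ncoords n A)) v :
  differentiable (fun t : 'cV[R]_(ncoords n A) => block t v) s.
Proof.
apply: differentiable_cV => k.
by case: (twice_diff_block k openT (x := s)).
Qed.

Lemma twice_diff_restr (A B : {set V}) (O : set 'cV[R]_(ncoords n B))
    (i : 'I_(ncoords n A)) :
  open O -> twice_diff O (fun s => restr A s i 0).
Proof.
move=> Oop; under eq_fun do rewrite mxE.
exact: twice_diff_block.
Qed.

(** A finite intersection of preimages of open sets under the continuous block
    maps. *)
Lemma open_prodU (A : {set V}) :
  (forall v, open (U v)) -> open (prodU U (A := A)).
Proof.
move=> Uop; rewrite openE => s Us; rewrite /interior /=.
suff : \forall t \near s, forall v, v \in A -> U v (block t v) by [].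
apply: (@filter_forall _ V (fun v t => v \in A -> U v (block t v)) (nbhs s) _) => v.
case vA: (v \in A); last exact: nearW.
have cont := differentiable_continuous (differentiable_block s v).
have : \forall t \near s, U v (block t v).
  by apply: cont; apply: open_nbhs_nbhs; split; [apply: Uop | apply: (Us v vA)].
by apply: filterS.
Qed.

Lemma prodU_concat (A : {set V}) (S : states R n) :
  (forall v, v \in A -> U v (S v)) -> prodU U (concat A S).
Proof. by move=> US v vA; rewrite block_concat //; apply: US. Qed.

Lemma prodU_restr (A B : {set V}) (s : 'cV[R]_(ncoords n B)) :
  A \subset B -> prodU U s -> prodU U (restr A s).
Proof.
by move=> AB Us; apply: prodU_concat => v /(fintype.subsetP AB); apply: Us.
Qed.

Lemma restr_concat (A B : {set V}) (S : states R n) : A \subset B ->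
  restr A (concat B S) = concat A S.
Proof.
move=> AB; apply: concat_eq => v vA; apply: block_concat.
exact: (fintype.subsetP AB).
Qed.

End Products.

(** * Forward propagation of the inputs *)

Section Structure.
Variables (R : realType) (V : finType) (e : rel V) (n : V -> nat).
Variable U : forall v : V, set 'cV[R]_(n v).
Arguments U : clear implicits.
Variables (phi : transitions R e n) (ell : local_objectives R e n).
Variables (S : states R n).
Arguments phi : clear implicits.
Arguments ell : clear implicits.
Arguments S : clear implicits.
Hypothesis e_acyclic : acyclic e.
Hypothesis U_open : forall v, open (U v).
Hypothesis phi_U : forall v, v \in noninputs e ->
  forall s, prodU U s -> U v (phi v s).
Hypothesis phi_C2 : forall v, v \in noninputs e ->
  cont_diff 2 (prodU U (A := parents e v)) (phi v).
Hypothesis ell_C2 : forall v,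
  cont_diff 2 (prodU U (A := v |: parents e v)) (ell v).
Hypothesis S_feasible : feasible U phi S.

Local Notation X := (inputs e).
Local Notation Y := (noninputs e).

Lemma notin_noninputs v : (v \notin Y) = (v \in X).
Proof. by rewrite !inE negbK. Qed.

(** One simultaneous round of evaluation: every noninput vertex is recomputed from
    the current states, and the inputs are reset to x. *)
Definition propagate (x : 'cV[R]_(ncoords n X)) (T : states R n) : states R n :=
  fun v => if v \in Y then phi v (concat (parents e v) T) else block x v.

(** Starting from the given feasible S keeps all iterates in the domains U, and
    makes S a fixed point of the iteration at its own inputs. *)
Definition iterate (k : nat) (x : 'cV[R]_(ncoords n X)) : states R n :=
  iter k (propagate x) S.

(** A vertex receives its final state at most one round after its parents, so the
    number of its ancestors, itself included, bounds the number of rounds. *)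
Lemma iterate_stable x k v : (#|[pred w | connect e w v]| <= k)%N ->
  iterate k.+1 x v = iterate k x v.
Proof.
elim: k v => [|k IHk] v.
  rewrite leqn0 => /eqP/card0_eq/(_ v).
  by rewrite !inE connect0.
move=> vk; rewrite /iterate iterS [in RHS]iterS /propagate; case: ifP => // vY.
congr (phi v _); apply: concat_eq => u; rewrite inE => uv.
by apply: IHk; rewrite -ltnS (leq_trans (ancestors_lt e_acyclic uv)).
Qed.

(** By [iterate_stable] all vertices are final after #|V| rounds. *)
Definition extension (x : 'cV[R]_(ncoords n X)) : states R n :=
  iterate #|V| x.

Lemma propagate_extension x : propagate x (extension x) = extension x.
Proof.
apply: functional_extensionality_dep => v; rewrite -[LHS]/(iterate #|V|.+1 x v).
by rewrite iterate_stable // max_card.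
Qed.

Lemma extension_input x v : v \in X -> extension x v = block x v.
Proof.
rewrite -notin_noninputs => /negbTE vY.
by rewrite -propagate_extension /propagate vY.
Qed.

Lemma extension_noninput x v : v \in Y ->
  extension x v = phi v (concat (parents e v) (extension x)).
Proof. by move=> vY; rewrite -[in LHS]propagate_extension /propagate vY. Qed.

Lemma concat_extension x : concat X (extension x) = x.
Proof.
by rewrite -[RHS]concat_block; apply: concat_eq => v; apply: extension_input.
Qed.

Lemma extension_base : extension (concat X S) = S.
Proof.
rewrite /extension; elim: #|V| => //= k IHk; rewrite IHk.
apply: functional_extensionality_dep => v; rewrite /propagate.
case: S_feasible => _ Sphi; case: ifPn => vY; first by rewrite -Sphi.
by rewrite block_concat // -notin_noninputs.
Qed.

Lemma iterate_U x k v : prodU U x -> U v (iterate k x v).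
Proof.
move=> Ux; elim: k v => [|k IHk] v; first by case: S_feasible.
rewrite /iterate iterS /propagate; case: ifPn => vY.
  by apply: phi_U => //; apply: prodU_concat => u _; apply: IHk.
by apply: Ux; rewrite -notin_noninputs.
Qed.

Lemma extension_feasible x : prodU U x -> feasible U phi (extension x).
Proof.
by move=> Ux; split=> v; [apply: iterate_U | apply: extension_noninput].
Qed.

(** Each round composes with a transition or selects an input coordinate; both
    preserve twice differentiability. *)
Lemma twice_diff_iterate k v (l : 'I_(n v)) :
  twice_diff (prodU U (A := X)) (fun x => iterate k x v l 0).
Proof.
have Oop : open (prodU U (A := X)) by apply: open_prodU.
elim: k v l => [|k IHk] v l; first exact: twice_diff_cst.
have [vY|vX] := boolP (v \in Y).
  have -> : (fun x => iterate k.+1 x v l 0) =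
      (fun s => phi v s l 0) \o (fun x => concat (parents e v) (iterate k x)).
    by apply/funext => x; rewrite /iterate iterS /propagate vY.
  apply: (twice_diff_comp (B := prodU U (A := parents e v)) Oop).
  - by move=> x Ux; apply: prodU_concat => u _; apply: iterate_U.
  - move=> j; under eq_fun do rewrite mxE.
    exact: IHk.
  - by apply: cont_diff2_coord; [apply: open_prodU | apply: phi_C2].
have -> : (fun x => iterate k.+1 x v l 0) = (fun x => block x v l 0).
  by apply/funext => x; rewrite /iterate iterS /propagate (negbTE vX).
exact: twice_diff_block.
Qed.

Definition all_states (x : 'cV[R]_(ncoords n X)) : 'cV[R]_(ncoords n [set: V]) :=
  concat [set: V] (extension x).

Lemma twice_diff_all_states j :
  twice_diff (prodU U (A := X)) (fun x => all_states x j 0).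
Proof. under eq_fun do rewrite mxE; exact: twice_diff_iterate. Qed.

Lemma differentiable_all_states x : prodU U x -> differentiable all_states x.
Proof.
by move=> Ux; apply: differentiable_cV => j; case: (twice_diff_all_states j Ux).
Qed.

Lemma all_states_U x : prodU U x -> prodU U (all_states x).
Proof. by move=> Ux; apply: prodU_concat => v _; apply: iterate_U. Qed.

Lemma restr_all_states x : restr X (all_states x) = x.
Proof. by rewrite restr_concat ?finset.subsetT // concat_extension. Qed.

Lemma constraint_all_states x : constraint phi (all_states x) = 0.
Proof.
rewrite /constraint block_concatT; apply/colP => i; rewrite !mxE.
have iY := tag_enum_val i.
by rewrite -extension_noninput // subrr.
Qed.

Lemma twice_diff_local_objective v :
  twice_diff (prodU U (A := [set: V]))
    (fun s => ell v (restr (v |: parents e v) s)).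
Proof.
have Oop : open (prodU U (A := [set: V])) by apply: open_prodU.
apply: (twice_diff_comp (B := prodU U (A := v |: parents e v))
  (f := fun s => restr _ s) Oop).
- by move=> s; apply: prodU_restr; apply: finset.subsetT.
- by move=> j; apply: twice_diff_restr.
- exact: cont_diff2_twice.
Qed.

Lemma twice_diff_transition v (l : 'I_(n v)) : v \in Y ->
  twice_diff (prodU U (A := [set: V]))
    (fun s => phi v (restr (parents e v) s) l 0).
Proof.
move=> vY; have Oop : open (prodU U (A := [set: V])) by apply: open_prodU.
apply: (twice_diff_comp (B := prodU U (A := parents e v))
  (f := fun s => restr _ s) (g := fun t => phi v t l 0) Oop).
- by move=> s; apply: prodU_restr; apply: finset.subsetT.
- by move=> j; apply: twice_diff_restr.
- by apply: cont_diff2_coord; [apply: open_prodU | apply: phi_C2].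
Qed.

Lemma twice_diff_constraint_at v (l : 'I_(n v)) : v \in Y ->
  twice_diff (prodU U (A := [set: V]))
    (fun s => constraint_at phi (block s) v l 0).
Proof.
move=> vY; have Oop : open (prodU U (A := [set: V])) by apply: open_prodU.
have -> : (fun s : 'cV[R]_(ncoords n [set: V]) =>
             constraint_at phi (block s) v l 0) =
          (fun s => phi v (restr (parents e v) s) l 0 + -1 * block s v l 0).
  by apply/funext => s; rewrite !mxE mulN1r.
apply: twice_diffD => //; first exact: twice_diff_transition.
by apply: twice_diffM => //; [exact: twice_diff_cst | exact: twice_diff_block].
Qed.

Lemma twice_diff_multiplier_term (lambda : 'cV[R]_(ncoords n Y)) v : v \in Y ->
  twice_diff (prodU U (A := [set: V]))
    (fun s => ((block lambda v)^T *m constraint_at phi (block s) v) 0 0).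
Proof.
move=> vY; have Oop : open (prodU U (A := [set: V])) by apply: open_prodU.
under eq_fun do rewrite mxE.
apply: twice_diff_sum => // l _; apply: twice_diffM => //.
  exact: twice_diff_cst.
exact: twice_diff_constraint_at.
Qed.

Lemma twice_diff_lagrangian lambda :
  twice_diff (prodU U (A := [set: V])) (fun s => lagrangian phi ell s lambda).
Proof.
have Oop : open (prodU U (A := [set: V])) by apply: open_prodU.
apply: twice_diffD => //; apply: twice_diff_sum => // v.
  by move=> _; exact: twice_diff_local_objective.
exact: twice_diff_multiplier_term.
Qed.

Lemma differentiable_constraint s : prodU U s -> differentiable (constraint phi) s.
Proof.
move=> Us; apply: differentiable_cV => i; under eq_fun do rewrite mxE.
by case: (twice_diff_constraint_at (tagged (enum_val i)) (tag_enum_val i) Us).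
Qed.

Local Notation s0 := (concat [set: V] S).
Local Notation x0 := (concat X S).

Lemma base_U : prodU U x0.
Proof. by apply: prodU_concat => v _; case: S_feasible. Qed.

Lemma all_states_base : all_states x0 = s0.
Proof. by rewrite /all_states extension_base. Qed.

Lemma states_U : prodU U s0.
Proof. by rewrite -all_states_base; apply: all_states_U; apply: base_U. Qed.

(** Chain rule for the identity h(E(x)) = 0. *)
Lemma jac_constraint_all_states :
  jac (constraint phi) s0 *m jac all_states x0 = 0.
Proof.
apply: mulmx_cV_inj => d; rewrite mul0mx -mulmxA.
rewrite (jac_mul_derive _ (differentiable_all_states base_U)).
rewrite (jac_mul_derive _ (differentiable_constraint states_U)).
rewrite -all_states_base -derive_comp.
- have -> : constraint phi \o all_states = cst 0.
    by apply/funext => x; exact: constraint_all_states.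
  exact: derive_cst.
- exact: differentiable_all_states base_U.
- by rewrite all_states_base; apply: differentiable_constraint states_U.
Qed.

(** Chain rule for the identity Q E(x) = x. *)
Lemma restr_jac_all_states d : restr X (jac all_states x0 *m d) = d.
Proof.
rewrite (jac_mul_derive _ (differentiable_all_states base_U)).
rewrite -[RHS](@derive_id _ _ x0).
have -> : id = restr X \o all_states.
  by apply/funext => x; rewrite /= restr_all_states.
rewrite derive_comp.
- by rewrite [RHS]derive_linear_fun // => h y; apply: restr_linear.
- exact: differentiable_all_states base_U.
- apply: differentiable_cV => i.
  by case: (twice_diff_restr i openT (x := all_states x0)).
Qed.

(** * Derivatives of the constraint and of the Lagrangian *)

(** The linearized recursion at the vertex v. *)
Lemma derive_constraint_at (s d : 'cV[R]_(ncoords n [set: V])) v (l : 'I_(n v)) :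
  v \in Y -> prodU U s ->
  'D_d (fun t : 'cV[R]_(ncoords n [set: V]) =>
          constraint_at phi (block t) v l 0) s =
  'D_(restr (parents e v) d) (fun t => phi v t l 0) (restr (parents e v) s)
  - block d v l 0.
Proof.
move=> vY Us.
have -> : (fun t : 'cV[R]_(ncoords n [set: V]) =>
             constraint_at phi (block t) v l 0) =
    ((fun t => phi v t l 0) \o restr (parents e v)) + (fun t => -1 * block t v l 0).
  by apply/funext => t; rewrite [LHS]mxE [X in _ + X]mxE -(mulN1r (block t v l 0)).
have [dphi _] := twice_diff_transition l vY Us.
have Oop : open (prodU U (A := [set: V])) by apply: open_prodU.
have [dbl _] := twice_diffM Oop (twice_diff_cst (-1)) (twice_diff_block l Oop) Us.
rewrite deriveD; [|exact: diff_derivable..].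
congr (_ + _).
  by apply: derive_affine_comp => h; rewrite restr_linear.
rewrite (derive_linear_fun (p := fun t => -1 * block t v l 0)) ?mulN1r //.
by move=> h y; rewrite block_linear !mulN1r !mxE opprD scalerN.
Qed.

(** The equation at v expresses the block of d at v through its blocks at the
    parents of v; starting from zero input blocks, all blocks vanish by induction
    along the graph. *)
Lemma constraint_jac_inj d :
  jac (constraint phi) s0 *m d = 0 -> restr X d = 0 -> d = 0.
Proof.
rewrite (jac_mul_derive _ (differentiable_constraint states_U)) => hd dX.
rewrite -[d]concat_block -[RHS]concat_block; apply: concat_eq => v _.
rewrite block0; apply: (acyclic_ind (P := fun v => block d v = 0) e_acyclic).
move=> {}v IHv; have [vY|] := boolP (v \in Y); last first.
  rewrite notin_noninputs => vX.
  by rewrite -(block_concat (block d) vX) -/(restr X d) dX block0.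
apply/colP => l; have [i iE] := coords_enum_val l vY.
have := congr1 (fun M : 'cV_ _ => M i 0) hd.
rewrite derive_coord; last exact: differentiable_constraint states_U.
under eq_fun do rewrite (concatE _ iE).
rewrite derive_constraint_at //; last exact: states_U.
have -> : restr (parents e v) d = 0.
  rewrite -[RHS]concat_block; apply: concat_eq => u.
  by rewrite inE block0 => /IHv.
by rewrite derive0 !mxE sub0r => /eqP; rewrite oppr_eq0 => /eqP.
Qed.

Lemma derive_lagrangian lambda (d : 'cV[R]_(ncoords n [set: V])) :
  'D_d (fun s => lagrangian phi ell s lambda) s0 =
  \sum_v 'D_(restr (v |: parents e v) d) (ell v) (concat (v |: parents e v) S) +
  \sum_(v in Y) \sum_l block lambda v l 0 *
    ('D_(restr (parents e v) d) (fun t => phi v t l 0) (concat (parents e v) S)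
     - block d v l 0).
Proof.
have Oop : open (prodU U (A := [set: V])) by apply: open_prodU.
have dell v := twice_diff_local_objective v.
have dlam v (vY : v \in Y) := twice_diff_multiplier_term lambda vY.
rewrite deriveD; first last.
- apply: diff_derivable.
  by case: (twice_diff_sum (index_enum V) Oop dlam states_U).
- apply: diff_derivable.
  by case: (twice_diff_sum (index_enum V) (P := predT) Oop
    (fun v _ => dell v) states_U).
congr (_ + _); rewrite derive_bigsum.
- apply: eq_bigr => v _; rewrite (derive_affine_comp (ell v)
    (p := restr (v |: parents e v)) (w := restr (v |: parents e v) d)).
    by rewrite restr_concat ?finset.subsetT.
  by move=> h; rewrite restr_linear.
- by move=> v _; case: (dell v _ states_U).
- apply: eq_bigr => v vY; under eq_fun do rewrite mxE.
  have dcon (l : 'I_(n v)) := twice_diff_constraint_at l vY states_U.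
  rewrite derive_bigsum => [|l _]; last first.
    by apply: differentiableM; [exact: differentiable_cst | case: (dcon l)].
  apply: eq_bigr => l _; rewrite [in LHS]mxE.
  rewrite deriveMl; last by apply: diff_derivable; case: (dcon l).
  by rewrite derive_constraint_at ?restr_concat ?finset.subsetT //; apply: states_U.
- by move=> v /dlam/(_ _ states_U)[].
Qed.

Lemma dfwith_id v : dfwith S (S v) = S.
Proof.
by apply: functional_extensionality_dep => u; case: dfwithP.
Qed.

Lemma concat_dfwith (A : {set V}) v (k : 'I_(n v))
    (j : 'I_(ncoords n [set: V])) (h : R) :
  enum_val j = Tagged (fun u => 'I_(n u)) k ->
  concat A (dfwith S (h *: delta_mx k 0 + S v)) =
  h *: restr A (delta_mx j 0 : 'cV[R]_(ncoords n [set: V])) +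
  concat A (dfwith S (S v)).
Proof.
by move=> jE; rewrite (dfwith_delta S h jE) dfwith_id -concat_linear.
Qed.

Lemma restr_delta0 (A : {set V}) v (k : 'I_(n v)) (j : 'I_(ncoords n [set: V])) :
  enum_val j = Tagged (fun u => 'I_(n u)) k -> v \notin A ->
  restr A (delta_mx j 0 : 'cV[R]_(ncoords n [set: V])) = 0.
Proof.
move=> jE vA; rewrite -[RHS]concat_block; apply: concat_eq => u uA.
by rewrite (block_delta_out _ jE) ?block0 //; apply: contraNneq vA => <-.
Qed.

Lemma partial_gradE (A : {set V}) (g : 'cV[R]_(ncoords n A) -> R) v (k : 'I_(n v))
    (j : 'I_(ncoords n [set: V])) :
  enum_val j = Tagged (fun u => 'I_(n u)) k ->
  partial_grad g S v k 0 =
  'D_(restr A (delta_mx j 0 : 'cV[R]_(ncoords n [set: V]))) g (concat A S).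
Proof.
move=> jE; rewrite [LHS]mxE.
rewrite (derive_affine_comp g (p := fun u => concat A (dfwith S u))
  (w := restr A (delta_mx j 0 : 'cV[R]_(ncoords n [set: V])))).
  by rewrite dfwith_id.
by move=> h; apply: concat_dfwith.
Qed.

Lemma partial_jacE (A : {set V}) q (g : 'cV[R]_(ncoords n A) -> 'cV[R]_q) v
    (k : 'I_(n v)) (l : 'I_q) (j : 'I_(ncoords n [set: V])) :
  enum_val j = Tagged (fun u => 'I_(n u)) k -> differentiable g (concat A S) ->
  partial_jac g S v l k =
  'D_(restr A (delta_mx j 0 : 'cV[R]_(ncoords n [set: V])))
    (fun t => g t l 0) (concat A S).
Proof.
move=> jE dg; rewrite [LHS]mxE.
rewrite (derive_affine_comp g (p := fun u => concat A (dfwith S u))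
  (w := restr A (delta_mx j 0 : 'cV[R]_(ncoords n [set: V])))).
  by rewrite dfwith_id derive_coord.
by move=> h; apply: concat_dfwith.
Qed.

(** Stationarity of the Lagrangian in the dependent states. A displacement of the
    state of v affects the local objectives of v and of its children, the
    transitions of its children, and, through - S_v, the constraint at v. The
    first two groups are the right-hand side of the reverse recursion at v, and
    the last contributes - lambda_v. *)
Lemma grad_lagrangian_noninput (df : states R n) lambda v (k : 'I_(n v))
    (j : 'I_(ncoords n [set: V])) :
  reverse_recursion phi ell S df ->
  (forall u, u \in Y -> block lambda u = df u) ->
  v \in Y -> enum_val j = Tagged (fun u => 'I_(n u)) k ->
  grad (fun s => lagrangian phi ell s lambda) s0 j 0 = 0.
Proof.
move=> dfE lambdaE vY jE; rewrite [LHS]mxE derive_lagrangian.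
set d : 'cV[R]_(ncoords n [set: V]) := delta_mx j 0.
have childY u : u \in children e v -> u \in Y.
  by rewrite !inE => vu; apply/set0Pn; exists v; rewrite inE.
have dphi u : u \in Y -> differentiable (phi u) (concat (parents e u) S).
  move=> uY; case: (phi_C2 uY) => dphiU _; apply: dphiU.
  by apply: prodU_concat => w _; case: S_feasible.
have ellE : \sum_u 'D_(restr (u |: parents e u) d) (ell u)
      (concat (u |: parents e u) S) =
    \sum_(u in v |: children e v) partial_grad (ell u) S v k 0.
  rewrite [RHS]big_mkcond; apply: eq_bigr => u _; rewrite /=.
  case: ifPn => [uv|uv]; first by rewrite (partial_gradE _ jE).
  rewrite (restr_delta0 jE) ?derive0 //; apply: contraNN uv.
  by rewrite !inE eq_sym.
have phiE : \sum_(u in Y) \sum_l block lambda u l 0 *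
      'D_(restr (parents e u) d) (fun t => phi u t l 0) (concat (parents e u) S) =
    \sum_(u in children e v) ((partial_jac (phi u) S v)^T *m df u) k 0.
  rewrite [RHS]big_mkcond [LHS]big_mkcond; apply: eq_bigr => u _ /=.
  have [uv|uv] := boolP (u \in children e v).
    have uY := childY u uv; rewrite uY mxE; apply: eq_bigr => l _.
    by rewrite [_^T _ _]mxE (partial_jacE _ jE) ?lambdaE 1?mulrC //; apply: dphi.
  case: ifP => // uY; apply: big1 => l _.
  rewrite (restr_delta0 jE) ?derive0 ?mulr0 //; apply: contraNN uv.
  by rewrite !inE.
(* The contribution, up to sign, of the terms - S_u in the constraints. *)
have blockE : \sum_(u in Y) \sum_l block lambda u l 0 * block d u l 0 =
    df v k 0.
  rewrite (bigD1 v) //= (bigD1 k) //= (block_delta_in jE).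
  rewrite [delta_mx _ _ _ _]mxE !eqxx mulr1.
  rewrite lambdaE // !big1 ?addr0 // => [u /andP[_ uv]|l lk].
    rewrite big1 // => l _.
    by rewrite (block_delta_out _ jE) // [X in _ * X]mxE mulr0.
  by rewrite [delta_mx _ _ _ _]mxE (negbTE lk) mulr0.
under [X in _ + X]eq_bigr do under eq_bigr do rewrite mulrBr.
under [X in _ + X]eq_bigr do rewrite sumrB.
rewrite sumrB ellE phiE blockE (dfE v) [X in _ - X]mxE !summxE.
by rewrite addrA subrr.
Qed.

(** * The objective as a restricted Lagrangian *)

(** The constraint vanishes at feasible states, so the multiplier terms drop out. *)
Lemma lagrangian_all_states f lambda x : has_structure U phi ell f ->
  prodU U x -> lagrangian phi ell (all_states x) lambda = f x.
Proof.
move=> fE Ux; rewrite -[in RHS](concat_extension x) fE; last first.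
  exact: extension_feasible.
rewrite /lagrangian block_concatT [X in _ + X]big1 ?addr0 // => v vY.
by rewrite /constraint_at -extension_noninput // subrr mulmx0 mxE.
Qed.

Lemma second_derivative_extension_input j (v w x : 'cV[R]_(ncoords n X)) :
  tag (enum_val j) \in X -> 'D_w ('D_v (fun y => all_states y j 0)) x = 0.
Proof.
move=> jX; have -> : (fun y => all_states y j 0) =
    (fun y => block y (tag (enum_val j)) (tagged (enum_val j)) 0).
  by apply/funext => y; rewrite mxE extension_input.
have -> : 'D_v (fun y : 'cV[R]_(ncoords n X) =>
      block y (tag (enum_val j)) (tagged (enum_val j)) 0) =
    cst (block v (tag (enum_val j)) (tagged (enum_val j)) 0).
  apply/funext => y.
  apply: (derive_linear_fun (p := fun y : 'cV[R]_(ncoords n X) =>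
      block y (tag (enum_val j)) (tagged (enum_val j)) 0)) => h z.
  by rewrite block_linear !mxE.
exact: derive_cst.
Qed.

Lemma grad_objective f lambda : has_structure U phi ell f ->
  grad f x0 =
  (jac all_states x0)^T *m grad (fun s => lagrangian phi ell s lambda) s0.
Proof.
move=> fE; have Oop : open (prodU U (A := X)) by apply: open_prodU.
rewrite -all_states_base -(grad_comp all_states_U twice_diff_all_states
  (twice_diff_lagrangian lambda) base_U).
apply: near_eq_grad; apply: (open_near_eq Oop base_U) => x Ux.
by rewrite /= (lagrangian_all_states _ fE Ux).
Qed.

Lemma hess_objective f df lambda : has_structure U phi ell f ->
  reverse_recursion phi ell S df ->
  (forall u, u \in Y -> block lambda u = df u) ->
  hess f x0 =
  (jac all_states x0)^T *m hess (fun s => lagrangian phi ell s lambda) s0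
    *m jac all_states x0.
Proof.
move=> fE dfE lambdaE; have Oop : open (prodU U (A := X)) by apply: open_prodU.
rewrite -all_states_base -(hess_comp_stationary Oop all_states_U
  twice_diff_all_states (twice_diff_lagrangian lambda) base_U).
  apply: (near_eq_hess Oop base_U) => x Ux.
  by rewrite /= (lagrangian_all_states _ fE Ux).
move=> j; rewrite all_states_base.
have [jY|] := boolP (tag (enum_val j) \in Y).
  left; apply: (grad_lagrangian_noninput dfE lambdaE jY (k := tagged (enum_val j))).
  by case: (enum_val j).
rewrite notin_noninputs => jX; right => v w.
exact: second_derivative_extension_input.
Qed.

End Structure.

Theorem theorem1 (R : realType) (V : finType) (e : rel V) (n : V -> nat)
    (U : forall v : V, set 'cV[R]_(n v))
    (phi : transitions R e n) (ell : local_objectives R e n)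
    (f : 'cV[R]_(ncoords n (inputs e)) -> R)
    (S df : states R n) (lambda : 'cV[R]_(ncoords n (noninputs e)))
    (e_acyclic : acyclic e)
    (U_open : forall v, open (U v))
    (phi_U : forall v, v \in noninputs e ->
       forall s, prodU U s -> U v (phi v s))
    (phi_C2 : forall v, v \in noninputs e ->
       cont_diff 2 (prodU U (A := parents e v)) (phi v))
    (ell_C2 : forall v, cont_diff 2 (prodU U (A := v |: parents e v)) (ell v))
    (f_structure : has_structure U phi ell f)
    (S_feasible : feasible U phi S)
    (df_reverse : reverse_recursion phi ell S df)
    (lambda_df : forall v, v \in noninputs e -> block lambda v = df v)
    (dSX : 'cV[R]_(ncoords n (inputs e))) :
  newton_step f (concat (inputs e) S) dSX <->
  exists (dSV : 'cV[R]_(ncoords n [set: V]))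
         (dlambda : 'cV[R]_(ncoords n (noninputs e))),
    lagrange_newton_step phi ell (concat [set: V] S) lambda dSV dlambda /\
    dSX = concat (inputs e) (block dSV).
Proof.
pose L t := lagrangian phi ell t lambda.
pose J := jac (all_states phi S) (concat (inputs e) S).
have [Q QE] := restr_mxE R n (inputs e) [set: V].
rewrite /newton_step (grad_objective e_acyclic U_open phi_U phi_C2 ell_C2
  S_feasible lambda f_structure).
rewrite (hess_objective e_acyclic U_open phi_U phi_C2 ell_C2
  S_feasible f_structure df_reverse lambda_df).
have AJ : jac (constraint phi) (concat [set: V] S) *m J = 0.
  exact: jac_constraint_all_states.
have QJ : Q *m J = 1%:M.
  apply: mulmx_cV_inj => d; rewrite -mulmxA -QE mul1mx.
  exact: restr_jac_all_states.
have inj (d : 'cV_(ncoords n [set: V])) :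
    jac (constraint phi) (concat [set: V] S) *m d = 0 ->
    Q *m d = 0 -> d = 0.
  by rewrite -QE; apply: constraint_jac_inj.
have h0 : constraint phi (concat [set: V] S) = 0.
  by rewrite -(all_states_base S_feasible) constraint_all_states.
have steps := reduced_newton_kkt (hess L (concat [set: V] S))
  (grad L (concat [set: V] S)) dSX AJ QJ inj.
rewrite /lagrange_newton_step h0 oppr0.
split=> [/steps[d [dl [kkt dE]]]|[d [dl [kkt dE]]]].
  by exists d, dl; split; rewrite // dE -QE.
by apply/steps; exists d, dl; split; rewrite // -QE.
Qed.
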